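(* Assume either the Continuum Hypothesis or Ostaszewski's $\clubsuit$-principle. Then there is an AD family $\mathcal{A}$ over a countable set which is $\omega$-inseparable and which codes every $\omega_1$-like partial order.
   Context: For sets $A,B$: $A\subseteq^* B$ means $A\setminus B$ is finite, and $A=^*B$ means $A\subseteq^*B$ and $B\subseteq^*A$. An AD family over a countable set $N$ is a family of infinite subsets of $N$ with pairwise finite intersections. For $n\geq 2$, a tuple $(\mathcal{L}_i:i<n)$ of families of subsets of $N$ is a pregap if $L\cap L'$ is finite whenever $L\in\mathcal{L}_i$, $L'\in\mathcal{L}_j$, $i\neq j$; a function $c:n\to\mathscr{P}(N)$ separates it if $L\subseteq^* c(i)$ for all $i<n$, $L\in\mathcal{L}_i$, and $\bigcap_{i<n}c(i)$ is finite; it is an $n$-gap if it is a pregap and no such $c$ exists. An AD family $\mathcal{A}$ is $n$-inseparable if for any pairwise disjoint uncountable $\mathcal{L}_0,\dots,\mathcal{L}_{n-1}\subseteq\mathcal{A}$ the tuple $(\mathcal{L}_i:i<n)$ is an $n$-gap; it is $\omega$-inseparable if it is $n$-inseparable for every $n\geq2$. $\clubsuit$: there is a sequence $\langle C_\delta:\delta\in\mathrm{Lim}\rangle$, $\mathrm{Lim}$ the set of nonzero countable limit ordinals, with $C_\delta\subseteq\delta$ of order type $\omega$ and $\sup C_\delta=\delta$, such that for every uncountable $S\subseteq\omega_1$ the set $\{\delta\in\mathrm{Lim}:C_\delta\subseteq S\}$ is stationary. A partial order $(X,\leq)$ is $\omega_1$-like if it is well-founded, $|X|=\omega_1$, and $(-\infty,x)=\{y:y<x\}$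 is countable for every $x$. $\inf(x,y)$ is the greatest lower bound when it exists; $x,y$ are incompatible if no $z$ satisfies $z\leq x,z\leq y$. $\mathrm{pred}(x)$ is the set of maximal elements of $(-\infty,x)$; $x$ is successor-like if $\mathrm{pred}(x)$ is finite and every $y<x$ is $\leq$ some $z\in\mathrm{pred}(x)$. An almost disjoint representation of $X$ is a pair $\langle T_x\rangle_{x\in X}$, $\langle A_x\rangle_{x\in X}$ of indexed families of infinite subsets of a countable set, $x\mapsto A_x$ injective and $\{A_x\}$ AD, such that for all $x,y$: (a) $A_x\subseteq T_x$; (b) $y\not\leq x\Rightarrow A_y\subseteq^*T_y\setminus T_x$; (c) if $\inf(x,y)$ exists, $T_x\cap T_y=^*T_{\inf(x,y)}$; (d) $x$ successor-like $\Rightarrow T_x\setminus\bigcup_{z\in\mathrm{pred}(x)}T_z=^*A_x$; (e) $x,y$ incompatible $\Rightarrow T_x\cap T_y=^*\emptyset$. An AD family $\mathcal{A}$ of size $\omega_1$ codes $X$ if there are a bijective indexing $\mathcal{A}=\{A_x:x\in X\}$ and sets $T_x$ making this an almost disjoint representation of $X$. *)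

(* Defs.v *)
From Stdlib Require Import Arith List.
Set Implicit Arguments.
Unset Strict Implicit.

Definition countable (T : Type) : Prop :=
  exists f : T -> nat, forall a b, f a = f b -> a = b.

Definition bijective_map (A B : Type) (f : A -> B) : Prop :=
  (forall a b, f a = f b -> a = b) /\ (forall y, exists x, f x = y).

Definition is_omega1 (W : Type) (lt : W -> W -> Prop) : Prop :=
  well_founded lt /\
  (forall a b c, lt a b -> lt b c -> lt a c) /\
  (forall a b, lt a b \/ a = b \/ lt b a) /\
  ~ countable W /\
  (forall a, countable {b : W | lt b a}).

Definition card_omega1 (W : Type) (T : Type) : Prop :=
  exists f : W -> T, bijective_map f.

Definition CH (W : Type) : Prop := card_omega1 W (nat -> bool).

Definition is_limit W (lt : W -> W -> Prop) (d : W) : Prop :=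
  (exists a, lt a d) /\ (forall a, lt a d -> exists b, lt a b /\ lt b d).

Definition club W (lt : W -> W -> Prop) (D : W -> Prop) : Prop :=
  (forall a, exists b, D b /\ lt a b) /\
  (forall d, is_limit lt d ->
     (forall a, lt a d -> exists b, D b /\ lt a b /\ lt b d) -> D d).

Definition stationary W (lt : W -> W -> Prop) (S : W -> Prop) : Prop :=
  forall D, club lt D -> exists d, S d /\ D d.

Definition ladder W (lt : W -> W -> Prop) (d : W) (C : W -> Prop) : Prop :=
  (exists c : nat -> W, (forall n, lt (c n) (c (S n))) /\
                        (forall w, C w <-> exists n, c n = w)) /\
  (forall w, C w -> lt w d) /\
  (forall a, lt a d -> exists w, C w /\ lt a w).

Definition clubsuit W (lt : W -> W -> Prop) : Prop :=
  exists C : W -> (W -> Prop),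
    (forall d, is_limit lt d -> ladder lt d (C d)) /\
    (forall S : W -> Prop, ~ countable {w : W | S w} ->
       stationary lt (fun d => is_limit lt d /\ forall w, C d w -> S w)).

Definition nset := nat -> Prop.
Definition finite_nat (S : nset) : Prop := exists m, forall k, S k -> k < m.
Definition sub_star (A B : nset) : Prop := finite_nat (fun k => A k /\ ~ B k).
Definition eq_star (A B : nset) : Prop := sub_star A B /\ sub_star B A.
Definition inter (A B : nset) : nset := fun k => A k /\ B k.
Definition diff (A B : nset) : nset := fun k => A k /\ ~ B k.

Definition family := nset -> Prop.

Definition AD_family (F : family) : Prop :=
  (forall A, F A -> ~ finite_nat A) /\
  (forall A B, F A -> F B -> A <> B -> finite_nat (inter A B)).

Definition pregap (n : nat) (L : nat -> family) : Prop :=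
  forall i j, i < n -> j < n -> i <> j ->
    forall X Y, L i X -> L j Y -> finite_nat (inter X Y).

Definition separates (n : nat) (L : nat -> family) (c : nat -> nset) : Prop :=
  (forall i, i < n -> forall X, L i X -> sub_star X (c i)) /\
  finite_nat (fun k => forall i, i < n -> c i k).

Definition n_gap (n : nat) (L : nat -> family) : Prop :=
  pregap n L /\ ~ exists c, separates n L c.

Definition n_inseparable (n : nat) (F : family) : Prop :=
  forall L : nat -> family,
    (forall i, i < n -> forall X, L i X -> F X) ->
    (forall i, i < n -> ~ countable {X : nset | L i X}) ->
    (forall i j, i < n -> j < n -> i <> j -> forall X, L i X -> L j X -> False) ->
    n_gap n L.

Definition omega_inseparable (F : family) : Prop :=
  forall n, 2 <= n -> n_inseparable n F.

Section PO.
Variables (X : Type) (le : X -> X -> Prop).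

Definition ltX (x y : X) : Prop := le x y /\ x <> y.

Definition omega1_like (W : Type) : Prop :=
  (forall x, le x x) /\
  (forall x y, le x y -> le y x -> x = y) /\
  (forall x y z, le x y -> le y z -> le x z) /\
  well_founded ltX /\
  card_omega1 W X /\
  (forall x, countable {y : X | ltX y x}).

Definition is_inf (x y z : X) : Prop :=
  le z x /\ le z y /\ forall w, le w x -> le w y -> le w z.

Definition incompatible (x y : X) : Prop := ~ exists z, le z x /\ le z y.

Definition in_pred (y x : X) : Prop :=
  ltX y x /\ ~ exists z, ltX y z /\ ltX z x.

Definition successor_like (x : X) : Prop :=
  (exists l : list X, forall y, in_pred y x <-> In y l) /\
  (forall y, ltX y x -> exists z, in_pred z x /\ le y z).

Definition AD_representation (T A : X -> nset) : Prop :=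
  (forall x y, A x = A y -> x = y) /\
  AD_family (fun S => exists x, S = A x) /\
  (forall x k, A x k -> T x k) /\
  (forall x y, ~ le y x -> sub_star (A y) (diff (T y) (T x))) /\
  (forall x y z, is_inf x y z -> eq_star (inter (T x) (T y)) (T z)) /\
  (forall x, successor_like x ->
     eq_star (fun k => T x k /\ ~ exists z, in_pred z x /\ T z k) (A x)) /\
  (forall x y, incompatible x y -> eq_star (inter (T x) (T y)) (fun _ => False)).

Definition codes (F : family) : Prop :=
  exists A : X -> nset,
    (forall S, F S <-> exists x, S = A x) /\
    (forall x y, A x = A y -> x = y) /\
    exists T : X -> nset, AD_representation T A.
End PO.

(* Main.v *)
(** Build partial functions [h a : omega -> {x | x <= a}] for [a < omega_1] that cohere:
    for [a < b], [h a] and the part of [h b] with values [<= a] differ at finitely many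
    points.  Put [A_a = (h a)^-1(a)], so [(h b)^-1(a) =* A_a] whenever [a <= b].

    Coding needs nothing else.  Index [X] by [omega_1] through any bijection [w], choose
    [b] above [w y] for all [y <= x], and let [T_x] be the set where [h b] takes a value
    [w y] with [y <= x].  By coherence, finitely many of the sets [T_x], [A_x] can be
    computed, modulo finite, from one function, where all clauses are immediate.

    For inseparability, fix sets [U_d], [d < omega_1], and at stage [a] make [A_a] meet in
    an infinite set every finite intersection [D] of the [U_d], [d <= a], that is not
    almost covered by the domain of an earlier function, while keeping [D] uncovered.
    Under CH the [U_d] are all subsets of [omega]; under club, [U_d] is the union of the
    [A_x] with [x] in the ladder [C_d].  If [A_x] is almost contained in [c(i)] for
    uncountably many [x], for each [i < n], then by induction on [j <= n] some such [D]
    stays uncovered and is almost contained in [c(0)], ..., [c(j-1)]: uncountably many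
    [A_x] meet [D] in an infinite set and are almost contained in [c(j)], so a suitable
    [U_d] almost contained in [c(j)] can be added to the intersection.  For [j = n] this
    makes the intersection of all [c(i)] infinite. *)

From Stdlib Require Import Arith List Lia Cantor.
From Stdlib Require Import Classical ClassicalEpsilon FunctionalExtensionality
  PropExtensionality ProofIrrelevance.
Require Import Defs.
Set Implicit Arguments.
Unset Strict Implicit.

Lemma functional_choice (A B : Type) (R : A -> B -> Prop) :
  (forall x, exists y, R x y) -> exists f, forall x, R x (f x).
Proof.
  intros H.
  exists (fun x => proj1_sig (constructive_indefinite_description _ (H x))).
  intros x. apply proj2_sig.
Qed.

(** * Infinite sets of natural numbers *)

Definition infinite_nat (S : nset) : Prop := forall m, exists k, m <= k /\ S k.

Lemma not_finite_nat (S : nset) : ~ finite_nat S <-> infinite_nat S.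
Proof.
  split.
  - intros H m. apply NNPP. intros N. apply H. exists m. intros k Hk.
    destruct (Nat.lt_ge_cases k m) as [|L]; [assumption|].
    exfalso. apply N. exists k. auto.
  - intros H [m Hm]. destruct (H m) as [k [L Hk]]. specialize (Hm k Hk). lia.
Qed.

Lemma infinite_nat_sub (m : nat) (S S' : nset) :
  (forall k, m <= k -> S k -> S' k) -> infinite_nat S -> infinite_nat S'.
Proof.
  intros H HS n. destruct (HS (max m n)) as [k [L Hk]].
  exists k. split; [lia|]. apply H; [lia|assumption].
Qed.

Lemma sub_star_from (m : nat) (S S' : nset) :
  (forall k, m <= k -> S k -> S' k) -> sub_star S S'.
Proof.
  intros H. exists m. intros k [K1 K2].
  destruct (Nat.lt_ge_cases k m); [assumption|]. exfalso. auto.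
Qed.

(** * Countability *)

Fixpoint decode_list (len c : nat) : list nat :=
  match len with
  | 0 => nil
  | S len' => fst (Cantor.of_nat c) :: decode_list len' (snd (Cantor.of_nat c))
  end.

Lemma decode_list_surj (l : list nat) : exists c, decode_list (length l) c = l.
Proof.
  induction l as [|x l [c Hc]]; [exists 0; reflexivity|].
  exists (Cantor.to_nat (x, c)). cbn [length decode_list].
  rewrite Cantor.cancel_of_to. cbn. now rewrite Hc.
Qed.

(** Makes the finite intersections to be met at one stage a countable list. A list is coded by its
    length together with one number that packs indices of its entries along [e]. *)
Lemma list_enumeration (T : Type) (e : nat -> T) :
  exists E : nat -> list T,
    forall l, (forall t, In t l -> exists i, e i = t) -> exists n, E n = l.
Proof.
  exists (fun n => map e (decode_list (fst (Cantor.of_nat n)) (snd (Cantor.of_nat n)))).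
  intros l Hl.
  assert (exists l', map e l' = l) as [l' <-].
  { induction l as [|t l IH]; [exists nil; reflexivity|].
    destruct IH as [l' Hl']; [intros; apply Hl; now right|].
    destruct (Hl t (or_introl eq_refl)) as [i Hi].
    exists (i :: l'). cbn. congruence. }
  destruct (decode_list_surj l') as [c Hc].
  exists (Cantor.to_nat (length l', c)).
  rewrite Cantor.cancel_of_to. cbn [fst snd]. now rewrite Hc.
Qed.

Lemma to_nat_inj (p q : nat * nat) : Cantor.to_nat p = Cantor.to_nat q -> p = q.
Proof.
  intros H. rewrite <- (Cantor.cancel_of_to p), <- (Cantor.cancel_of_to q).
  now rewrite H.
Qed.

Lemma countable_inj (A B : Type) (f : A -> B) :
  (forall a b, f a = f b -> a = b) -> countable B -> countable A.
Proof. intros Hf [g Hg]. exists (fun a => g (f a)). intros a b H. auto. Qed.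

Lemma countable_sub (T : Type) (P Q : T -> Prop) :
  (forall t, P t -> Q t) -> countable {t | Q t} -> countable {t | P t}.
Proof.
  intros H. apply countable_inj with
    (f := fun p : {t | P t} => exist Q (proj1_sig p) (H _ (proj2_sig p))).
  intros [a Ha] [b Hb] E. apply (f_equal (@proj1_sig _ _)) in E. cbn in E. subst b.
  f_equal. apply proof_irrelevance.
Qed.

Lemma countable_predP (T : Type) (P : T -> Prop) :
  countable {t | P t} ->
  exists f : T -> nat, forall a b, P a -> P b -> f a = f b -> a = b.
Proof.
  intros [f Hf].
  exists (fun t => match excluded_middle_informative (P t) with
                   | left H => f (exist _ t H) | right _ => 0 end).
  intros a b Pa Pb.
  destruct (excluded_middle_informative (P a)) as [Ha|]; [|contradiction].
  destruct (excluded_middle_informative (P b)) as [Hb|]; [|contradiction].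
  intros E. apply Hf in E. exact (f_equal (@proj1_sig _ _) E).
Qed.

Lemma countable_union (I T : Type) (J : I -> Prop) (P : I -> T -> Prop) (Q : T -> Prop) :
  countable {i | J i} ->
  (forall i, J i -> countable {t | P i t}) ->
  (forall t, Q t -> exists i, J i /\ P i t) ->
  countable {t | Q t}.
Proof.
  intros HJ HP HQ.
  destruct (countable_predP HJ) as [c Hc].
  assert (exists f : I -> T -> nat,
            forall i, J i -> forall a b, P i a -> P i b -> f i a = f i b -> a = b)
    as [f Hf].
  { apply functional_choice with
      (R := fun i g => J i -> forall a b, P i a -> P i b -> g a = g b -> a = b).
    intros i. destruct (classic (J i)) as [Hi|Hi].
    - destruct (countable_predP (HP i Hi)) as [g Hg]. exists g. auto.
    - exists (fun _ => 0). contradiction. }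
  assert (exists s : {t | Q t} -> I, forall t, J (s t) /\ P (s t) (proj1_sig t)) as [s Hs].
  { apply functional_choice with (R := fun t i => J i /\ P i (proj1_sig t)).
    intros [t Ht]. auto. }
  exists (fun t => Cantor.to_nat (c (s t), f (s t) (proj1_sig t))).
  intros a b E. apply to_nat_inj in E. injection E as E1 E2.
  apply Hc in E1; [|apply Hs|apply Hs]. rewrite E1 in E2.
  apply Hf in E2; [|apply Hs|rewrite <- E1; apply Hs|apply Hs].
  destruct a as [a Ha], b as [b Hb]. cbn in E2. subst b. f_equal. apply proof_irrelevance.
Qed.

Lemma uncountable_piece (T : Type) (P : nat -> T -> Prop) (Q : T -> Prop) :
  (forall t, Q t -> exists n, P n t) ->
  ~ countable {t | Q t} -> exists n, ~ countable {t | P n t}.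
Proof.
  intros H HQ. apply NNPP. intros N. apply HQ.
  apply (@countable_union nat T (fun _ => True) P Q).
  - exists (@proj1_sig _ _). intros [a []] [b []] E. cbn in E. now subst.
  - intros n _. apply NNPP. intros N'. apply N. now exists n.
  - intros t Ht. destruct (H t Ht) as [n Hn]. now exists n.
Qed.

(** * Amalgamating a coherent sequence of partial functions *)

(** Supplies block endpoints: [M n] will be a threshold past which finite errors have vanished, and
    [P n s t] will say that enough points lie between [s] and [t]. Monotonicity in [t] permits
    overshooting, so a single sum meets all three demands. *)
Lemma sparse_sequence (M : nat -> nat) (P : nat -> nat -> nat -> Prop) :
  (forall n s, exists t, P n s t) ->
  (forall n s t t', t <= t' -> P n s t -> P n s t') ->
  exists m : nat -> nat,
    (forall n, m n < m (S n)) /\ (forall n, M n <= m n) /\ (forall n, P n (m n) (m (S n))).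
Proof.
  intros HP mono.
  assert (exists N : nat * nat -> nat, forall p, P (fst p) (snd p) (N p)) as [N HN]
    by (apply functional_choice with (R := fun p t => P (fst p) (snd p) t); intros [n s]; apply HP).
  set (m := fix m n := match n with
                       | 0 => M 0
                       | S n' => M n + S (m n') + N (n', m n') end).
  exists m. repeat split.
  - intros n. cbn [m]. fold m. lia.
  - intros [|n]; cbn [m]; fold m; lia.
  - intros n. apply mono with (t := N (n, m n)).
    + cbn [m]. fold m. lia.
    + apply (HN (n, m n)).
Qed.

Lemma block_of (m : nat -> nat) :
  (forall n, m n < m (S n)) ->
  (forall n n', n <= n' -> m n <= m n') /\
  (forall k, m 0 <= k -> exists n, m n <= k < m (S n)).
Proof.
  intros Hm.
  assert (mono : forall n n', n <= n' -> m n <= m n').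
  { induction 1; [lia|]. specialize (Hm m0). lia. }
  split; [exact mono|].
  assert (grow : forall n, n <= m n) by (induction n; [lia|]; specialize (Hm n); lia).
  intros k H0.
  assert (forall j, k < m j -> exists n, m n <= k < m (S n)) as H.
  { induction j as [|j IH]; [lia|]. intros Hj.
    destruct (Nat.lt_ge_cases k (m j)); [auto|]. exists j. lia. }
  apply (H (S k)). specialize (grow (S k)). lia.
Qed.

Lemma bounded_choice (n : nat) (Q : nat -> nat -> Prop) :
  (forall i m m', m <= m' -> Q i m -> Q i m') ->
  (forall i, i <= n -> exists m, Q i m) ->
  exists m, forall i, i <= n -> Q i m.
Proof.
  intros mono. induction n as [|n IH]; intros H.
  - destruct (H 0 (le_n 0)) as [m Hm]. exists m. intros i Hi.
    now replace i with 0 by lia.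
  - destruct IH as [m Hm]; [auto|]. destruct (H (S n) (le_n _)) as [m' Hm'].
    exists (m + m'). intros i Hi. destruct (Nat.eq_dec i (S n)) as [->|].
    + apply mono with (m := m'); [lia|assumption].
    + apply mono with (m := m); [lia|apply Hm; lia].
Qed.

Section Amalgamation.
Variables (W : Type) (B : nat -> W -> Prop) (G : nat -> nat -> option W).
Variables (D : nat -> nset) (a : W).
Hypothesis G_range : forall n k x, G n k = Some x -> B n x.
Hypothesis G_coherent : forall i n, i <= n ->
  exists m, forall k, m <= k -> forall x, B i x -> (G i k = Some x <-> G n k = Some x).
Hypothesis D_uncovered : forall i n, infinite_nat (fun k => D i k /\ G n k = None).
Hypothesis a_new : forall n, ~ B n a.

(* On the block [m n, m (S n)) the amalgam follows [G n]; on even blocks all remaining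
   points get the new value [a], on odd blocks they stay undefined.  Every block contains
   points of [D 0], ..., [D n] outside the domain of [G n]. *)
Lemma amalgam :
  exists g : nat -> option W,
    (forall k x, g k = Some x -> x = a \/ exists n, B n x) /\
    (forall i, exists m, forall k, m <= k -> forall x, B i x ->
       (G i k = Some x <-> g k = Some x)) /\
    (forall i, infinite_nat (fun k => D i k /\ g k = Some a)) /\
    (forall i, infinite_nat (fun k => D i k /\ g k = None)).
Proof.
  assert (exists M : nat -> nat, forall n, forall i, i <= n -> forall k, M n <= k ->
            forall x, B i x -> (G i k = Some x <-> G n k = Some x)) as [M HM].
  { apply functional_choice with
      (R := fun n m => forall i, i <= n -> forall k, m <= k ->
            forall x, B i x -> (G i k = Some x <-> G n k = Some x)).
    intros n. apply bounded_choice with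
      (Q := fun i m => forall k, m <= k -> forall x, B i x ->
              (G i k = Some x <-> G n k = Some x)).
    - intros i m m' L H k Hk. apply H. lia.
    - intros i Hi. now apply G_coherent. }
  destruct (@sparse_sequence M (fun n s t => forall i, i <= n ->
      exists k, (s <= k /\ k < t) /\ D i k /\ G n k = None)) as (m & m_incr & m_large & m_pts).
  { intros n s. apply bounded_choice with
      (Q := fun i t => exists k, (s <= k /\ k < t) /\ D i k /\ G n k = None).
    - intros i t t' L (k & Hk & Hk'). exists k. split; [lia|auto].
    - intros i _. destruct (D_uncovered i n s) as (k & Hk & Hk').
      exists (S k), k. split; [lia|auto]. }
  { intros n s t t' L H i Hi. destruct (H i Hi) as (k & Hk & Hk').
    exists k. split; [lia|auto]. }
  destruct (block_of m_incr) as [m_mono m_block].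
  set (val := fun n k => match G n k with
                         | Some x => Some x
                         | None => if Nat.even n then Some a else None end).
  assert (exists g : nat -> option W, forall k,
            (k < m 0 -> g k = None) /\
            (forall n, m n <= k < m (S n) -> g k = val n k)) as [g Hg].
  { apply functional_choice with
      (R := fun k v => (k < m 0 -> v = None) /\
                       (forall n, m n <= k < m (S n) -> v = val n k)).
    intros k. destruct (Nat.lt_ge_cases k (m 0)) as [L|L].
    - exists None. split; [auto|]. intros n Hn.
      specialize (m_mono 0 n ltac:(lia)). lia.
    - destruct (m_block k L) as [n Hn]. exists (val n k). split; [lia|].
      intros n' Hn'. f_equal.
      destruct (Nat.lt_trichotomy n n') as [H|[H|H]]; [|assumption|].
      + specialize (m_mono (S n) n' H). lia.
      + specialize (m_mono (S n') n H). lia. }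
  assert (m_ge : forall n, n <= m n).
  { induction n; [lia|]. specialize (m_incr n). lia. }
  exists g. repeat split.
  - intros k x Hx. destruct (Nat.lt_ge_cases k (m 0)) as [L|L].
    + rewrite (proj1 (Hg k) L) in Hx. discriminate.
    + destruct (m_block k L) as [n Hn]. rewrite (proj2 (Hg k) n Hn) in Hx.
      unfold val in Hx. destruct (G n k) as [y|] eqn:E.
      * right. exists n. injection Hx as <-. eauto.
      * left. destruct (Nat.even n); congruence.
  - intros i. exists (m i). intros k Hk x Hx.
    destruct (m_block k) as [n Hn]; [specialize (m_mono 0 i ltac:(lia)); lia|].
    assert (i <= n).
    { destruct (Nat.le_gt_cases i n) as [|H]; [assumption|].
      specialize (m_mono (S n) i H). lia. }
    (* Past [m n] the functions [G i] and [G n] agree on the value [x], and [g] adds to [G n] only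
       the value [a], which [B i] omits. *)
    rewrite (proj2 (Hg k) n Hn).
    rewrite (HM n i H k ltac:(specialize (m_large n); lia) x Hx).
    unfold val. destruct (G n k) as [y|]; [tauto|].
    split; [discriminate|]. destruct (Nat.even n); [|discriminate].
    intros E. injection E as <-. now apply a_new in Hx.
  (* An even block whose index is at least [i], so that it contains a point of [D i], and at least
     [s], so that it starts at or beyond [s]. *)
  - intros i s. set (n := 2 * (i + s)).
    destruct (m_pts n i ltac:(lia)) as (k & Hk & HD & HG).
    exists k. specialize (m_ge n). split; [lia|]. split; [assumption|].
    rewrite (proj2 (Hg k) n ltac:(lia)). unfold val. rewrite HG.
    unfold n. now rewrite Nat.even_mul.
  - intros i s. set (n := S (2 * (i + s))).
    destruct (m_pts n i ltac:(lia)) as (k & Hk & HD & HG).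
    exists k. specialize (m_ge n). split; [lia|]. split; [assumption|].
    rewrite (proj2 (Hg k) n ltac:(lia)). unfold val. rewrite HG.
    unfold n. now rewrite Nat.even_succ, <- Nat.negb_even, Nat.even_mul.
Qed.

End Amalgamation.

(** * The first uncountable ordinal *)

Section Omega1.
Variables (W : Type) (lt : W -> W -> Prop).
Hypothesis W_omega1 : is_omega1 lt.

Let le (a b : W) : Prop := lt a b \/ a = b.

Lemma wf_irrefl a : ~ lt a a.
Proof.
  destruct W_omega1 as [wf _]. induction (wf a) as [a _ IH]. intros H. now apply (IH a).
Qed.

Lemma lt_trans a b c : lt a b -> lt b c -> lt a c.
Proof. destruct W_omega1 as (_ & tr & _). apply tr. Qed.

Lemma le_lt_trans a b c : le a b -> lt b c -> lt a c.
Proof. intros [H| ->]; [|auto]. now apply lt_trans. Qed.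

Lemma lt_le_trans a b c : lt a b -> le b c -> lt a c.
Proof. intros H [H'| <-]; [|auto]. now apply lt_trans with b. Qed.

Lemma le_trans a b c : le a b -> le b c -> le a c.
Proof. intros [H| ->]; [|auto]. intros H'. left. now apply lt_le_trans with b. Qed.

Lemma le_or_gt a b : le a b \/ lt b a.
Proof. destruct W_omega1 as (_ & _ & tot & _). unfold le. destruct (tot a b); tauto. Qed.

Lemma not_le_gt a b : le a b -> lt b a -> False.
Proof. intros H H'. apply (@wf_irrefl a). now apply le_lt_trans with b. Qed.

Lemma exists_upper a b : exists c, le a c /\ le b c.
Proof.
  destruct (le_or_gt a b); [exists b|exists a]; unfold le in *; tauto.
Qed.

Lemma countable_le a : countable {b | le b a}.
Proof.
  destruct W_omega1 as (_ & _ & _ & _ & cnt).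
  destruct (countable_predP (cnt a)) as [f Hf].
  exists (fun b => if excluded_middle_informative (proj1_sig b = a)
                   then 0 else S (f (proj1_sig b))).
  intros [b Hb] [c Hc]. cbn.
  assert (b = c -> exist (fun b => le b a) b Hb = exist _ c Hc) as K.
  { intros ->. f_equal. apply proof_irrelevance. }
  destruct (excluded_middle_informative (b = a)), (excluded_middle_informative (c = a));
    try discriminate.
  - intros _. apply K. congruence.
  - intros E. apply K. apply Hf; [now destruct Hb|now destruct Hc|congruence].
Qed.

Lemma uncountable_unbounded (S : W -> Prop) b :
  ~ countable {w | S w} -> exists w, S w /\ lt b w.
Proof.
  intros H. apply NNPP. intros N. apply H.
  apply countable_sub with (Q := fun w => le w b); [|apply countable_le].
  intros w Hw. destruct (le_or_gt w b) as [|L]; [assumption|].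
  exfalso. apply N. eauto.
Qed.

Lemma uncountable_full : ~ countable {w : W | True}.
Proof.
  destruct W_omega1 as (_ & _ & _ & unc & _). intros H. apply unc.
  apply countable_inj with (f := fun w => exist (fun _ : W => True) w I); [|assumption].
  intros a b E. exact (f_equal (@proj1_sig _ _) E).
Qed.

Lemma exists_gt a : exists b, lt a b.
Proof.
  destruct (uncountable_unbounded a uncountable_full) as [b [_ H]]. eauto.
Qed.

Lemma omega1_inhabited : exists a : W, True.
Proof.
  apply NNPP. intros N. apply uncountable_full. exists (fun _ => 0).
  intros [a ?]. exfalso. apply N. now exists a.
Qed.

Lemma countable_bounded (I : Type) (J : I -> Prop) (w : I -> W) :
  countable {i | J i} -> exists b, forall i, J i -> le (w i) b.
Proof.
  intros HJ. apply NNPP. intros N. apply uncountable_full.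
  apply countable_union with (J := J) (P := fun i t => lt t (w i)); [assumption| |].
  - intros i _. destruct W_omega1 as (_ & _ & _ & _ & cnt). apply cnt.
  - intros t _. apply NNPP. intros N'. apply N. exists t. intros i Hi.
    destruct (le_or_gt (w i) t) as [|L]; [assumption|]. exfalso. apply N'. eauto.
Qed.

Lemma enumerate_le a :
  exists e : nat -> W, forall b, le b a <-> exists n, e n = b.
Proof.
  destruct (countable_predP (countable_le a)) as [f Hf].
  assert (exists e : nat -> W, forall n,
            le (e n) a /\ forall b, le b a -> f b = n -> e n = b) as [e He].
  { apply functional_choice with
      (R := fun n w => le w a /\ forall b, le b a -> f b = n -> w = b).
    intros n. destruct (classic (exists b, le b a /\ f b = n)) as [[b [Hb Hn]]|N].
    - exists b. split; [assumption|]. intros c Hc Ec. apply Hf; congruence.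
    - exists a. split; [now right|]. intros c Hc Ec. exfalso. apply N. eauto. }
  exists e. intros b. split.
  - intros Hb. exists (f b). now apply He.
  - intros [n <-]. apply He.
Qed.

(** The chain is only weakly increasing, so successor and limit [a] are treated alike: below a
    successor it becomes constant. It consists of running maxima of an enumeration. *)
Lemma cofinal_chain a b0 : lt b0 a ->
  exists c : nat -> W,
    (forall n, lt (c n) a) /\ (forall i n, i <= n -> le (c i) (c n)) /\
    (forall b, lt b a -> exists n, le b (c n)).
Proof.
  intros H0. destruct (enumerate_le a) as [e He].
  set (mx := fun x y => if excluded_middle_informative (lt x y) then y else x).
  assert (mx_l : forall x y, le x (mx x y)).
  { intros x y. unfold mx. destruct (excluded_middle_informative (lt x y)); [now left|now right]. }
  assert (mx_r : forall x y, le y (mx x y)).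
  { intros x y. unfold mx. destruct (excluded_middle_informative (lt x y)); [now right|].
    destruct (le_or_gt y x); [assumption|contradiction]. }
  (* The enumeration [e] also hits [a] itself; those entries are replaced by [b0]. *)
  set (e' := fun n => if excluded_middle_informative (lt (e n) a) then e n else b0).
  assert (e'_lt : forall n, lt (e' n) a).
  { intros n. unfold e'. now destruct (excluded_middle_informative (lt (e n) a)). }
  set (c := fix c n := match n with 0 => b0 | S n' => mx (c n') (e' n') end).
  exists c. repeat split.
  - induction n as [|n IH]; [assumption|]. cbn. unfold mx at 1.
    now destruct (excluded_middle_informative (lt (c n) (e' n))).
  - intros i n. induction 1 as [|n _ IH]; [now right|].
    apply le_trans with (c n); [assumption|]. apply mx_l.
  - intros b Hb. destruct (proj1 (He b) (or_introl Hb)) as [n <-].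
    exists (S n). cbn. replace (e n) with (e' n) at 1; [apply mx_r|].
    unfold e'. now destruct (excluded_middle_informative (lt (e n) a)).
Qed.

(** Transfinite recursion with choices. By [loc] a stage looks only below itself, so the earlier
    values padded with [g0] can stand for a total function. Since [ex] presupposes success at
    earlier stages, [epsilon] chooses unconditionally and induction shows afterwards that the
    choices are right. *)
Lemma wf_choice (G : Type) (g0 : G) (step : W -> (W -> G) -> G -> Prop) :
  (forall a h h' g, (forall b, lt b a -> h b = h' b) -> step a h g -> step a h' g) ->
  (forall a h, (forall b, lt b a -> step b h (h b)) -> exists g, step a h g) ->
  exists h, forall a, step a h (h a).
Proof.
  intros loc ex. destruct W_omega1 as [wf _].
  set (ext := fun a (rec : forall b, lt b a -> G) b =>
                match excluded_middle_informative (lt b a) with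
                | left H => rec b H | right _ => g0 end).
  set (F := fun a rec => epsilon (inhabits g0) (step a (ext a rec))).
  set (h := Fix wf (fun _ => G) F).
  assert (h_eq : forall a, h a = F a (fun b _ => h b)).
  { intros a. unfold h. apply (@Fix_eq W lt wf (fun _ => G) F). intros x f f' Hf.
    replace f' with f; [reflexivity|].
    extensionality b. extensionality H. apply Hf. }
  assert (ext_eq : forall a b, lt b a -> h b = ext a (fun b _ => h b) b).
  { intros a b H. unfold ext. now destruct (excluded_middle_informative (lt b a)). }
  exists h. intros a. induction (wf a) as [a _ IH].
  apply loc with (h := ext a (fun b _ => h b)); [intros; symmetry; auto|].
  rewrite (h_eq a). unfold F. apply epsilon_spec.
  destruct (ex a h IH) as [g Hg]. exists g. apply loc with (h := h); auto.
Qed.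

(** * The construction *)

Definition fiber (h : W -> nat -> option W) (x : W) : nset := fun k => h x k = Some x.

Section Construction.
(* [U A d] is a set that the construction of [A] has to respect from stage [d] on. *)
Variable U : (W -> nset) -> W -> nset.
Hypothesis U_local : forall A A' d,
  (forall x, lt x d -> A x = A' x) -> U A d = U A' d.

(** These are the finite intersections [D] of the overview; the empty list yields all of omega. *)
Definition request (h : W -> nat -> option W) (l : list W) : nset :=
  fun k => forall d, In d l -> U (fiber h) d k.

(** Infinitude of the request is asked separately because at the least [a] the condition on earlier
    [b] is vacuous. *)
Definition step (a : W) (h : W -> nat -> option W) (g : nat -> option W) : Prop :=
  (forall k x, g k = Some x -> le x a) /\
  (forall b, lt b a -> exists m, forall k, m <= k -> forall x, le x b ->
     (h b k = Some x <-> g k = Some x)) /\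
  (forall l, (forall d, In d l -> le d a) ->
     infinite_nat (request h l) ->
     (forall b, lt b a -> infinite_nat (fun k => request h l k /\ h b k = None)) ->
     infinite_nat (fun k => request h l k /\ g k = Some a) /\
     infinite_nat (fun k => request h l k /\ g k = None)).

(** Even the index [d = a] is allowed: [U A a] reads only the fibers strictly below [a], so the
    request is settled before [h a] is chosen. *)
Lemma request_local a h h' l :
  (forall b, lt b a -> h b = h' b) -> (forall d, In d l -> le d a) ->
  forall k, request h l k <-> request h' l k.
Proof.
  intros E Hl k.
  assert (forall d, In d l -> U (fiber h) d = U (fiber h') d) as H.
  { intros d Hd. apply U_local. intros x Hx. unfold fiber.
    rewrite E; [reflexivity|]. apply lt_le_trans with d; auto. }
  split; intros HR d Hd; specialize (HR d Hd); specialize (H d Hd); congruence.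
Qed.

Lemma step_local a h h' g :
  (forall b, lt b a -> h b = h' b) -> step a h g -> step a h' g.
Proof.
  intros E (S1 & S2 & S3). split; [assumption|split].
  - intros b Hb. rewrite <- E by assumption. auto.
  - intros l Hl HD HD'. pose proof (request_local E Hl) as R.
    destruct (S3 l Hl) as [P Q].
    + apply infinite_nat_sub with 0 (request h' l); [|assumption].
      intros k _. apply R.
    + intros b Hb. rewrite E by assumption.
      apply (@infinite_nat_sub 0 _ _) with (2 := HD' b Hb).
      intros k _ [K1 K2]. split; [now apply R|assumption].
    + split; [apply (@infinite_nat_sub 0 _ _) with (2 := P)
             |apply (@infinite_nat_sub 0 _ _) with (2 := Q)];
        intros k _ [K1 K2]; (split; [now apply R|assumption]).
Qed.

(** The request of the empty list is all of omega, so the last clause of [step] carries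
    uncoveredness from stage to stage. *)
Lemma step_uncovered a h :
  (forall b, lt b a -> step b h (h b)) ->
  forall b, lt b a -> infinite_nat (fun k => h b k = None).
Proof.
  intros H b. destruct W_omega1 as [wf _].
  induction (wf b) as [b _ IH]. intros Hb.
  destruct (H b Hb) as (_ & _ & S3). destruct (S3 nil) as [_ Q].
  - intros d [].
  - intros m. exists m. split; [auto|]. intros d [].
  - intros c Hc. apply (@infinite_nat_sub 0 (fun k => h c k = None)).
    + intros k _ K. split; [intros d []|assumption].
    + apply IH; [assumption|]. now apply lt_trans with b.
  - apply (@infinite_nat_sub 0 _ _) with (2 := Q). tauto.
Qed.

(** Only countably many lists have all entries up to [a], so one amalgamation along a cofinal chain
    serves all of them. *)
Lemma step_exists a h : (forall b, lt b a -> step b h (h b)) -> exists g, step a h g.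
Proof.
  intros H. pose proof (step_uncovered H) as unc.
  destruct (enumerate_le a) as [e He].
  destruct (list_enumeration e) as [E HE].
  set (ok := fun l => infinite_nat (request h l) /\
     forall b, lt b a -> infinite_nat (fun k => request h l k /\ h b k = None)).
  (* The implication turns a request that need not be met into all of omega, so that every [D n] is
     uncovered. *)
  set (D := fun n k => ok (E n) -> request h (E n) k).
  assert (HD : forall n b, lt b a -> infinite_nat (fun k => D n k /\ h b k = None)).
  { intros n b Hb. destruct (classic (ok (E n))) as [Hok|Hok].
    - apply (@infinite_nat_sub 0 _ _) with (2 := proj2 Hok b Hb).
      intros k _ [K1 K2]. split; [intros _|]; assumption.
    - apply (@infinite_nat_sub 0 _ _) with (2 := unc b Hb).
      intros k _ K. split; [intros N; contradiction|assumption]. }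
  assert (HD' : forall n, infinite_nat (D n)).
  { intros n. destruct (classic (ok (E n))) as [Hok|Hok].
    - apply (@infinite_nat_sub 0 _ _) with (2 := proj1 Hok).
      intros k _ K _. assumption.
    - intros m. exists m. split; [auto|]. intros N. contradiction. }
  assert (exists g : nat -> option W,
    (forall k x, g k = Some x -> le x a) /\
    (forall b, lt b a -> exists m, forall k, m <= k -> forall x, le x b ->
       (h b k = Some x <-> g k = Some x)) /\
    (forall i, infinite_nat (fun k => D i k /\ g k = Some a)) /\
    (forall i, infinite_nat (fun k => D i k /\ g k = None)))
    as (g & g1 & g2 & g3 & g4).
  { destruct (classic (exists b0, lt b0 a)) as [[b0 Hb0]|N].
    - destruct (cofinal_chain Hb0) as (c & c_lt & c_mono & c_cof).
      assert (coh : forall b b', le b b' -> lt b' a -> exists m, forall k, m <= k ->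
                forall x, le x b -> (h b k = Some x <-> h b' k = Some x)).
      { intros b b' [L| ->] L'; [|exists 0; tauto]. now apply (H b' L'). }
      destruct (@amalgam W (fun n x => le x (c n)) (fun n => h (c n)) D a)
        as (g & g1 & g2 & g3).
      + intros n k x. apply (H (c n) (c_lt n)).
      + intros i n L. apply coh; auto.
      + intros i n. apply HD, c_lt.
      + intros n L. now apply (not_le_gt L).
      + exists g. split; [|split]; [| |assumption].
        * intros k x Hx. destruct (g1 k x Hx) as [->|[n Hn]]; [now right|].
          left. now apply le_lt_trans with (c n).
        * intros b Hb. destruct (c_cof b Hb) as [n Hn].
          destruct (coh b (c n) Hn (c_lt n)) as [m Hm]. destruct (g2 n) as [m' Hm'].
          exists (m + m'). intros k Hk x Hx.
          rewrite Hm by (lia || assumption). apply Hm'; [lia|].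
          now apply le_trans with b.
    (* For the least [a], nowhere defined functions are amalgamated. *)
    - destruct (@amalgam W (fun _ _ => False) (fun _ _ => None) D a)
        as (g & g1 & _ & g3); try tauto.
      + discriminate.
      + intros. exists 0. tauto.
      + intros i _. apply (@infinite_nat_sub 0 _ _) with (2 := HD' i). auto.
      + exists g. split; [|split]; [| |assumption].
        * intros k x Hx. destruct (g1 k x Hx) as [->|[n []]]. now right.
        * intros b Hb. exfalso. eauto. }
  exists g. split; [assumption|split; [assumption|]].
  intros l Hl HR HR'. destruct (HE l) as [n Hn]; [intros t Ht; now apply He, Hl|].
  assert (ok (E n)) as Hok by (rewrite Hn; split; assumption).
  split; [apply (@infinite_nat_sub 0 _ _) with (2 := g3 n)
         |apply (@infinite_nat_sub 0 _ _) with (2 := g4 n)];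
    intros k _ [K1 K2]; (split; [|assumption]); rewrite <- Hn; now apply K1.
Qed.

Lemma construction : exists h, forall a, step a h (h a).
Proof.
  apply (@wf_choice _ (fun _ => None)); [apply step_local|apply step_exists].
Qed.

End Construction.

Definition coherent (h : W -> nat -> option W) : Prop :=
  (forall a k x, h a k = Some x -> le x a) /\
  (forall a b, le a b -> exists m, forall k, m <= k -> forall x, le x a ->
     (h a k = Some x <-> h b k = Some x)) /\
  (forall a, infinite_nat (fiber h a)).

Lemma fiber_coherent h : coherent h -> forall a b, le a b ->
  exists m, forall k, m <= k -> (fiber h a k <-> h b k = Some a).
Proof.
  intros (_ & coh & _) a b L. destruct (coh a b L) as [m Hm].
  exists m. intros k Hk. apply Hm; [assumption|now right].
Qed.

(** Modulo finite, both fibers are preimages of distinct values under one function [h c]. *)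
Lemma fiber_disjoint h : coherent h -> forall a b, a <> b ->
  finite_nat (inter (fiber h a) (fiber h b)).
Proof.
  intros Hh a b N. destruct (exists_upper a b) as (c & La & Lb).
  destruct (fiber_coherent Hh La) as [m Hm], (fiber_coherent Hh Lb) as [m' Hm'].
  exists (m + m'). intros k [K1 K2].
  destruct (Nat.lt_ge_cases k (m + m')) as [|L]; [assumption|exfalso].
  apply Hm in K1; [|lia]. apply Hm' in K2; [|lia]. congruence.
Qed.

Lemma fiber_inj h : coherent h -> forall a b, fiber h a = fiber h b -> a = b.
Proof.
  intros Hh a b E. apply NNPP. intros N.
  pose proof (fiber_disjoint Hh N) as F. rewrite E in F.
  destruct Hh as (_ & _ & inf). apply (proj2 (not_finite_nat (fiber h b)) (inf b)).
  destruct F as [m Hm]. exists m. intros k K. apply Hm. now split.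
Qed.

Lemma fiber_AD h : coherent h -> AD_family (fun S => exists x, S = fiber h x).
Proof.
  intros Hh. split.
  - intros S [x ->]. apply not_finite_nat, Hh.
  - intros S S' [x ->] [y ->] N. apply fiber_disjoint; [assumption|]. congruence.
Qed.

(** * Coding *)

Section Coding.
Variables (h : W -> nat -> option W) (X : Type) (leX : X -> X -> Prop).
Variables (w : X -> W) (bd : X -> W).
Hypothesis h_coherent : coherent h.
Hypothesis w_inj : forall x y, w x = w y -> x = y.
Hypothesis leX_refl : forall x, leX x x.
Hypothesis leX_antisym : forall x y, leX x y -> leX y x -> x = y.
Hypothesis leX_trans : forall x y z, leX x y -> leX y z -> leX x z.
Hypothesis bdP : forall x y, leX y x -> le (w y) (bd x).

Let A (x : X) : nset := fiber h (w x).
(** The first disjunct adds only finitely many points; it makes the inclusion of [A x] in [T x]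
    exact, as clause (a) demands. *)
Let T (x : X) : nset := fun k => A x k \/ exists y, leX y x /\ h (bd x) k = Some (w y).

(* Modulo finite sets, [A] and [T] are read off from the single function [h b]. *)
Let reads (b : W) (k : nat) (x : X) : Prop :=
  (A x k <-> h b k = Some (w x)) /\
  (T x k <-> exists y, leX y x /\ h b k = Some (w y)).

Lemma reads_single b x : le (bd x) b ->
  exists m, forall k, m <= k -> reads b k x.
Proof.
  intros L. destruct h_coherent as (_ & coh & _).
  assert (le (w x) b) as Lx by (apply le_trans with (bd x); auto).
  destruct (fiber_coherent h_coherent Lx) as [m1 H1].
  destruct (coh _ _ L) as [m2 H2].
  exists (m1 + m2). intros k Hk. unfold reads, T.
  split; [apply H1; lia|]. split.
  - intros [K|(y & Hy & K)].
    + exists x. split; [auto|]. apply H1; [lia|assumption].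
    + exists y. split; [assumption|]. apply H2; [lia|auto|assumption].
  - intros (y & Hy & K). right. exists y. split; [assumption|].
    apply H2; [lia|auto|assumption].
Qed.

Lemma reads_list (l : list X) :
  exists b m, forall k, m <= k -> forall x, In x l -> reads b k x.
Proof.
  assert (exists b, forall x, In x l -> le (bd x) b) as [b Hb].
  { induction l as [|x l [b Hb]].
    - destruct omega1_inhabited as [b _]. exists b. intros x [].
    - destruct (exists_upper b (bd x)) as (c & L1 & L2). exists c.
      intros y [<-|Hy]; [assumption|]. apply le_trans with b; auto. }
  exists b. induction l as [|x l IH]; [exists 0; intros k _ x []|].
  destruct IH as [m Hm]; [intros y Hy; apply Hb; now right|].
  destruct (@reads_single b x) as [m' Hm']; [apply Hb; now left|].
  exists (m + m'). intros k Hk y [<-|Hy]; [apply Hm'; lia|apply Hm; [lia|assumption]].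
Qed.

(** Each clause on [T] and [A] involves finitely many elements of [X]. Past a threshold their sets
    are decided at [k] by the one value [h b k], and the clause becomes a statement about which [y]
    satisfies [h b k = Some (w y)]. *)
Lemma representation : AD_representation leX T A.
Proof.
  assert (A_inj : forall x y, A x = A y -> x = y)
    by (intros x y E; apply w_inj, (fiber_inj h_coherent E)).
  split; [assumption|]. split; [|split; [|split; [|split; [|split]]]].
  - destruct (fiber_AD h_coherent) as [AD1 AD2]. split.
    + intros S [x ->]. apply AD1. now exists (w x).
    + intros S S' [x ->] [y ->]. apply AD2; [now exists (w x)|now exists (w y)].
  - intros x k K. now left.
  - intros x y N. destruct (reads_list (x :: y :: nil)) as (b & m & H).
    apply sub_star_from with m. intros k Hk K.
    destruct (H k Hk x ltac:(cbn; auto)) as [_ Tx].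
    destruct (H k Hk y ltac:(cbn; auto)) as [Ay _].
    split; [now left|]. intros K'. apply Tx in K'. destruct K' as (z & Hz & Ez).
    apply Ay in K. assert (y = z) by (apply w_inj; congruence). now subst z.
  - intros x y z (Hx & Hy & Hz). destruct (reads_list (x :: y :: z :: nil)) as (b & m & H).
    split; apply sub_star_from with m; intros k Hk;
      destruct (H k Hk x ltac:(cbn; auto)) as [_ Tx];
      destruct (H k Hk y ltac:(cbn; auto)) as [_ Ty];
      destruct (H k Hk z ltac:(cbn; auto)) as [_ Tz].
    + intros [K1 K2]. apply Tx in K1. apply Ty in K2. apply Tz.
      destruct K1 as (u & Hu & Eu), K2 as (v & Hv & Ev).
      assert (u = v) by (apply w_inj; congruence). subst v. exists u. auto.
    + intros K. apply Tz in K. destruct K as (u & Hu & Eu).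
      split; [apply Tx|apply Ty]; exists u; eauto.
  - intros x [[l Hl] Hs]. destruct (reads_list (x :: l)) as (b & m & H).
    split; apply sub_star_from with m; intros k Hk;
      destruct (H k Hk x ltac:(cbn; auto)) as [Ax Tx].
    + intros [K1 K2]. apply Tx in K1. destruct K1 as (u & Hu & Eu).
      destruct (classic (u = x)) as [->|N]; [now apply Ax|].
      exfalso. destruct (Hs u) as (z & Hz & Lz); [now split|].
      apply K2. exists z. split; [assumption|].
      apply (H k Hk z); [right; now apply Hl|]. eauto.
    + intros K. split; [now left|]. intros (z & Hz & K').
      apply (H k Hk z) in K'; [|right; now apply Hl].
      destruct K' as (u & Hu & Eu). apply Ax in K.
      assert (x = u) by (apply w_inj; congruence). subst u.
      destruct Hz as [[Hz1 Hz2] _]. apply Hz2. now apply leX_antisym.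
  - intros x y N. destruct (reads_list (x :: y :: nil)) as (b & m & H).
    split; apply sub_star_from with m; intros k Hk; [|contradiction].
    destruct (H k Hk x ltac:(cbn; auto)) as [_ Tx].
    destruct (H k Hk y ltac:(cbn; auto)) as [_ Ty].
    intros [K1 K2]. apply Tx in K1. apply Ty in K2. apply N.
    destruct K1 as (u & Hu & Eu), K2 as (v & Hv & Ev).
    assert (u = v) by (apply w_inj; congruence). subst v. exists u. auto.
Qed.

End Coding.

Lemma coherent_codes h (X : Type) (leX : X -> X -> Prop) :
  coherent h -> omega1_like leX W -> codes leX (fun S => exists x, S = fiber h x).
Proof.
  intros Hh (refl & antisym & trans & _ & [f [f_inj f_surj]] & cnt).
  destruct (@functional_choice _ _ (fun x a => f a = x) f_surj) as [w Hw].
  assert (w_inj : forall x y, w x = w y -> x = y)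
    by (intros x y E; rewrite <- (Hw x), <- (Hw y); congruence).
  assert (exists bd : X -> W, forall x y, leX y x -> le (w y) (bd x)) as [bd Hbd].
  { apply functional_choice with (R := fun x b => forall y, leX y x -> le (w y) b).
    intros x. destruct (countable_bounded w (cnt x)) as [b Hb].
    destruct (exists_upper b (w x)) as (c & L1 & L2). exists c. intros y Hy.
    destruct (classic (y = x)) as [->|N]; [assumption|].
    apply le_trans with b; [|assumption]. apply Hb. now split. }
  pose proof (@representation h X leX w bd Hh w_inj refl antisym trans Hbd) as R.
  exists (fun x => fiber h (w x)). split; [|split; [|eexists; exact R]].
  - intros S. split; [|intros [x ->]; eauto].
    (* The right inverse [w] of the bijection [f] is onto, so the reindexing misses no fiber. *)
    intros [a ->]. exists (f a). f_equal. apply f_inj. now rewrite Hw.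
  - apply R.
Qed.

(** * Inseparability *)

Section Inseparability.
Variable U : (W -> nset) -> W -> nset.
Variable h : W -> nat -> option W.
Hypothesis h_step : forall a, step U a h (h a).

Definition uncovered (l : list W) (b : W) : Prop :=
  (forall d, In d l -> le d b) /\ infinite_nat (request U h l) /\
  forall c, lt c b -> infinite_nat (fun k => request U h l k /\ h c k = None).

(** Below [b] uncoveredness is given; from [b] on all entries of [l] are admissible, and the last
    clause of [step] both preserves it and puts infinitely many points into the new fiber. *)
Lemma uncovered_persists l b : uncovered l b -> forall a, le b a ->
  infinite_nat (fun k => request U h l k /\ h a k = Some a).
Proof.
  intros (Hl & HR & Hc).
  assert (forall c, infinite_nat (fun k => request U h l k /\ h c k = None)) as K.
  { intros c. destruct W_omega1 as [wf _]. induction (wf c) as [c _ IH].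
    destruct (le_or_gt b c) as [L|L]; [|auto].
    apply (h_step c); [|assumption|exact IH].
    intros d Hd. apply le_trans with b; auto. }
  intros a L. apply (h_step a); [|assumption|intros c _; apply K].
  intros d Hd. apply le_trans with b; auto.
Qed.

Lemma uncovered_nil b : uncovered nil b.
Proof.
  split; [intros d []|split].
  - intros m. exists m. split; [auto|]. intros d [].
  - intros c Hc. apply (@infinite_nat_sub 0 (fun k => h c k = None)).
    + intros k _ K. split; [intros d []|assumption].
    + apply (@step_uncovered U b h); auto.
Qed.

Lemma step_coherent : coherent h.
Proof.
  split; [|split].
  - intros a. apply (h_step a).
  - intros a b [L| ->]; [|exists 0; tauto]. now apply (h_step b).
  - intros a. apply (@infinite_nat_sub 0 _ _)
      with (2 := uncovered_persists (uncovered_nil a) (or_intror eq_refl)).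
    intros k _ [_ K]. exact K.
Qed.

(* Weak enough to follow both from CH ([U] lists all subsets of omega, so [U d = c] for
   some [d]) and from club ([U d] is the union of the fibers over the ladder at [d]). *)
Hypothesis guessing : forall (c : nset) (S : W -> Prop) (b : W),
  ~ countable {x | S x} -> (forall x, S x -> sub_star (fiber h x) c) ->
  exists d b', le d b' /\ lt b b' /\ sub_star (U (fiber h) d) c /\
    forall e, lt e b' ->
      exists x, le b x /\ lt e x /\ sub_star (fiber h x) (U (fiber h) d).

(** For [e] below [b'], guessing gives [x] beyond [e] whose fiber is almost inside the new set. The
    old request meets this fiber infinitely often. There [h e] is almost everywhere undefined: a
    value [y] of [h e] would by coherence be the value of [h x], but [y] is at most [e] and so
    differs from [x]. *)
Lemma uncovered_step c S l b :
  uncovered l b ->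
  ~ countable {x | S x} -> (forall x, S x -> sub_star (fiber h x) c) ->
  exists d b', uncovered (d :: l) b' /\ sub_star (U (fiber h) d) c.
Proof.
  intros Hl HS Hc. destruct (guessing b HS Hc) as (d & b' & Ld & Lb & Hd & Hx).
  exists d, b'. split; [|assumption].
  assert (forall e, lt e b' ->
    infinite_nat (fun k => request U h (d :: l) k /\ h e k = None)) as K.
  { intros e He. destruct (Hx e He) as (x & Lx & Lex & m & Hm).
    destruct step_coherent as (rng & coh & _).
    destruct (coh e x (or_introl Lex)) as [m' Hm'].
    apply (@infinite_nat_sub (m + m') _ _) with (2 := uncovered_persists Hl Lx).
    intros k Hk [K1 K2]. split.
    - intros d' [<-|Hd']; [|now apply K1]. apply NNPP. intros N.
      specialize (Hm k (conj K2 N)). lia.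
    - destruct (h e k) as [y|] eqn:E; [exfalso|reflexivity].
      pose proof (rng _ _ _ E) as Ly. apply Hm' in E; [|lia|assumption].
      assert (y = x) as -> by congruence. exact (not_le_gt Ly Lex). }
  split; [|split; [|assumption]].
  - intros d' [<-|Hd']; [assumption|]. left. apply le_lt_trans with b; [|assumption].
    now apply Hl.
  - apply (@infinite_nat_sub 0 _ _) with (2 := K b Lb). tauto.
Qed.

Lemma inseparable : omega_inseparable (fun S => exists x, S = fiber h x).
Proof.
  intros n Hn L LF Lunc Ldisj. split.
  - intros i j Hi Hj N S S' HS HS'.
    apply (fiber_AD step_coherent); [eauto..|]. intros ->. eauto.
  - intros (c & Hc & [m Hm]).
    assert (forall j, j <= n -> exists l b, uncovered l b /\
              exists m, forall k, m <= k -> request U h l k -> forall i, i < j -> c i k) as H.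
    { induction j as [|j IH]; intros Hj.
      - destruct omega1_inhabited as [b _]. exists nil, b.
        split; [apply uncovered_nil|]. exists 0. lia.
      - destruct IH as (l & b & Hl & m1 & Hm1); [lia|].
        destruct (@uncovered_step (c j) (fun x => L j (fiber h x)) l b Hl)
          as (d & b' & Hd & m2 & Hm2).
        (* Uncountability is known for the sets in [L j] and needed for their indices; choosing an
           index for each set is injective. *)
        + intros C. apply (Lunc j Hj).
          assert (exists s : {S | L j S} -> W, forall S, proj1_sig S = fiber h (s S)) as [s Hs].
          { apply functional_choice with (R := fun S x => proj1_sig S = fiber h x).
            intros [S HS]. eapply LF; eauto. }
          apply countable_inj with (B := {x | L j (fiber h x)})
            (f := fun S => exist (fun x => L j (fiber h x)) (s S)
                     (eq_ind _ (L j) (proj2_sig S) _ (Hs S))); [|assumption].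
          intros a b0 E. apply (f_equal (@proj1_sig _ _)) in E. cbn in E.
          assert (proj1_sig a = proj1_sig b0) as E' by (rewrite !Hs; congruence).
          destruct a as [a Ha], b0 as [b0 Hb0]. cbn in E'. subst b0.
          f_equal. apply proof_irrelevance.
        + intros x Hx. now apply Hc.
        + exists (d :: l), b'. split; [assumption|]. exists (m1 + m2).
          intros k Hk K i Hi. destruct (Nat.eq_dec i j) as [->|].
          * apply NNPP. intros N. specialize (K d (or_introl eq_refl)).
            specialize (Hm2 k (conj K N)). lia.
          * apply Hm1; [lia| |lia]. intros d' Hd'. apply K. now right. }
    destruct (H n (le_n n)) as (l & b & (_ & HR & _) & m' & Hm').
    destruct (HR (m + m')) as (k & Hk & K).
    specialize (Hm k (Hm' k ltac:(lia) K)). lia.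
Qed.

End Inseparability.

(** * The family under CH and under club *)

Definition has_inseparable_coding_family : Prop :=
  exists F : family,
    AD_family F /\ card_omega1 W {S : nset | F S} /\ omega_inseparable F /\
    (forall (X : Type) (leX : X -> X -> Prop), omega1_like leX W -> codes leX F).

Lemma inseparable_coding_family (U : (W -> nset) -> W -> nset) :
  (forall A A' d, (forall x, lt x d -> A x = A' x) -> U A d = U A' d) ->
  (forall h, coherent h -> forall (c : nset) (S : W -> Prop) (b : W),
     ~ countable {x | S x} -> (forall x, S x -> sub_star (fiber h x) c) ->
     exists d b', le d b' /\ lt b b' /\ sub_star (U (fiber h) d) c /\
       forall e, lt e b' ->
         exists x, le b x /\ lt e x /\ sub_star (fiber h x) (U (fiber h) d)) ->
  has_inseparable_coding_family.
Proof.
  intros U_local guessing. destruct (construction U_local) as [h Hh].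
  pose proof (step_coherent Hh) as coh.
  exists (fun S => exists x, S = fiber h x). split; [|split; [|split]].
  - now apply fiber_AD.
  - exists (fun x => exist _ (fiber h x) (ex_intro _ x eq_refl)). split.
    + intros a b E. apply (fiber_inj coh). exact (f_equal (@proj1_sig _ _) E).
    + intros [S HS]. destruct HS as [x Hx]. exists x. subst S. f_equal.
  - apply (inseparable Hh). now apply guessing.
  - intros X leX. now apply coherent_codes.
Qed.

Lemma CH_family : CH W -> has_inseparable_coding_family.
Proof.
  intros [f [_ f_surj]].
  apply (@inseparable_coding_family (fun _ d k => f d k = true)); [reflexivity|].
  intros h _ c S b HS Hc.
  destruct (f_surj (fun k => if excluded_middle_informative (c k) then true else false))
    as [d Hd].
  assert (forall k, f d k = true <-> c k) as Hd'.
  { intros k. rewrite Hd. now destruct (excluded_middle_informative (c k)). }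
  (* As [U d] equals [c], every later [x] in [S] is a witness; [b'] only has to exceed [b] and
     [d]. *)
  destruct (exists_upper b d) as (b1 & L1 & L2). destruct (exists_gt b1) as [b' L].
  exists d, b'. split; [left; now apply le_lt_trans with b1|].
  split; [now apply le_lt_trans with b1|]. split.
  - exists 0. intros k [K1 K2]. exfalso. now apply K2, Hd'.
  - intros e He. destruct (uncountable_unbounded b' HS) as (x & Hx & Lx).
    exists x. split; [|split].
    + left. apply le_lt_trans with b1; [assumption|]. now apply lt_trans with b'.
    + now apply lt_trans with b'.
    + destruct (Hc x Hx) as [m Hm]. exists m. intros k [K1 K2]. apply Hm.
      split; [assumption|]. intros K. now apply K2, Hd'.
Qed.

Lemma clubsuit_family : clubsuit lt -> has_inseparable_coding_family.
Proof.
  intros (C & ladC & guessC).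
  apply (@inseparable_coding_family
           (* The bound [lt x d] gives locality also at non-limit [d], where [C d] is arbitrary. *)
           (fun A d k => exists x, (C d x /\ lt x d) /\ A x k)).
  { intros A A' d E. extensionality k. f_equal. extensionality x.
    apply propositional_extensionality. split; intros [[K1 K2] K3];
      [rewrite <- E|rewrite E]; auto. }
  intros h _ c Z b HZ Hc.
  (* Each fiber has its own finite error against [c], and a union over a ladder could accumulate
     these. Hence [Z] is first cut to an uncountable piece beyond [b] with one error bound [m];
     piece 0 collects the countably many [x] up to [b]. *)
  destruct (@uncountable_piece W
    (fun n x => match n with
                | 0 => le x b
                | S m => (Z x /\ lt b x) /\ forall k, fiber h x k -> ~ c k -> k < m
                end) Z) as [[|m] Hm]; [|exact HZ|contradiction (Hm (countable_le b))|].
  { intros x Hx. destruct (le_or_gt x b) as [L|L]; [now exists 0|].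
    destruct (Hc x Hx) as [m Hm]. exists (S m). auto. }
  (* One guess suffices, so stationarity is applied to the trivial club. *)
  destruct (guessC _ Hm (fun _ => True)) as (d & [lim_d Cd] & _).
  { split; [|auto]. intros a. destruct (exists_gt a) as [a' L]. eauto. }
  destruct (ladC d lim_d) as (_ & C_lt & C_cof).
  exists d, d. split; [now right|]. split; [|split].
  - destruct lim_d as [[a La] _]. destruct (C_cof a La) as (x & Hx & _).
    destruct (Cd x Hx) as [[_ L] _]. now apply lt_trans with x; [|apply C_lt].
  - exists m. intros k [(x & [Hx _] & K) N]. now apply (proj2 (Cd x Hx)).
  - intros e He. destruct (C_cof e He) as (x & Hx & L). exists x.
    destruct (Cd x Hx) as [[_ L'] _]. split; [now left|]. split; [assumption|].
    exists 0. intros k [K1 K2]. exfalso. apply K2. eauto 6.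
Qed.

End Omega1.

Unset Implicit Arguments.

Theorem mainTheorem4 :
  forall (W : Type) (ltW : W -> W -> Prop),
    is_omega1 ltW ->
    (CH W \/ clubsuit ltW) ->
    exists F : family,
      AD_family F /\
      card_omega1 W {S : nset | F S} /\
      omega_inseparable F /\
      (forall (X : Type) (le : X -> X -> Prop),
          omega1_like le W -> codes le F).
Proof.
  intros W ltW HW [H|H]; [exact (CH_family HW H)|exact (clubsuit_family HW H)].
Qed.
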